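(* Let $X$ be a compact metric space and let $F:X\to 2^X$ be upper semi-continuous. Suppose there exist a point $p\in X$ and two distinct periodic orbits $\mathbf{a}=(a_i)_{i\in\mathbb{Z}}$ and $\mathbf{b}=(b_i)_{i\in\mathbb{Z}}$ of $F$ such that $a_0=b_0=p$. Then $h(F)>0$.
   Context: $\mathbb{N}=\{1,2,\ldots\}$. For a compact metric space $X$ with metric $d$, $2^X$ is the set of non-empty compact subsets of $X$. $F:X\to 2^X$ is upper semi-continuous if for every $x\in X$ and every open $V\subseteq X$ containing $F(x)$ there is an open $U\ni x$ with $F(t)\subseteq V$ for all $t\in U$. Periodic orbits: a full orbit of $F$ is a sequence $\mathbf{x}=(x_i)_{i\in\mathbb{Z}}$ in $X$ with $x_{i+1}\in F(x_i)$ for all $i\in\mathbb{Z}$; it is periodic if there is $m\in\mathbb{N}$ with $x_i=x_{i+m}$ for all $i\in\mathbb{Z}$. Two orbits are distinct if they are different as sequences. Entropy: for $n\in\mathbb{N}$, $\mathrm{Orb}_n(X,F)$ is the set of $n$-orbits, i.e. finite sequences $(x_0,\ldots,x_{n-1})$ in $X$ with $x_{i+1}\in F(x_i)$ for $0\le i\le n-2$, with the metric $D(\mathbf{x},\mathbf{y})=\max_{0\le i\le n-1}d(x_i,y_i)$. A subset of a metric space is $\epsilon$-separated if any two of its distinct points are at distance $\ge\epsilon$. $s_{n,\epsilon}(F)$ is the largest cardinality of an $\epsilon$-separated subset of $(\mathrm{Orb}_n(X,F),D)$, and the topological entropy of $F$ is $h(F)=\lim_{\epsilon\to0}\limsup_{n\to\infty}\frac1n\log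 s_{n,\epsilon}(F)\in[0,\infty]$. *)

(* Defs.v *)
From HB Require Import structures.
From mathcomp Require Import all_boot all_order all_algebra.
From mathcomp Require Import all_classical all_reals all_analysis.
Set Implicit Arguments.
Unset Strict Implicit.
Unset Printing Implicit Defensive.
Import Order.TTheory GRing.Theory Num.Theory.
Import numFieldTopology.Exports numFieldNormedType.Exports.
Local Open Scope classical_set_scope.
Local Open Scope ring_scope.

(* The family written 2^X in the literature. *)
Definition hyperspace (X : topologicalType) : set (set X) :=
  [set A | A !=set0 /\ compact A].

Definition upper_semicontinuous (X : topologicalType) (F : X -> set X) : Prop :=
  forall (x : X) (V : set X), open V -> F x `<=` V ->
    exists U : set X, [/\ open U, U x & forall t, U t -> F t `<=` V].

Definition full_orbit (X : Type) (F : X -> set X) (x : int -> X) : Prop :=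
  forall i : int, F (x i) (x (i + 1)).

Definition periodic_orbit (X : Type) (F : X -> set X) (x : int -> X) : Prop :=
  full_orbit F x /\
  exists m : nat, (0 < m)%N /\ forall i : int, x i = x (i + m%:Z).

Definition Orb (X : Type) (F : X -> set X) (n : nat) : set {ffun 'I_n -> X} :=
  [set x | forall i j : 'I_n, j = i.+1 :> nat -> F (x i) (x j)].

Definition orb_dist (R : realType) (X : metricType R) (n : nat)
    (x y : {ffun 'I_n -> X}) : R :=
  \big[Num.max/0]_(i < n) mdist (x i) (y i).

Definition eps_separated (R : realType) (T : Type) (d : T -> T -> R) (eps : R)
    (S : set T) : Prop :=
  forall x y, S x -> S y -> x <> y -> eps <= d x y.

(* When X is compact and eps > 0 the cardinalities below are bounded, so this
   supremum is attained, i.e. it is the largest cardinality of an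
   eps-separated subset of Orb F n. *)
Definition sep_number (R : realType) (X : metricType R) (F : X -> set X)
    (n : nat) (eps : R) : \bar R :=
  ereal_sup [set (k%:R)%:E | k in [set k : nat |
    exists S : set {ffun 'I_n -> X},
      [/\ S `<=` @Orb X F n, eps_separated (@orb_dist R X n) eps S
        & (S #= `I_k)%card]]].

(* The term n = 0 is irrelevant for the limit superior. *)
Definition entropy_at (R : realType) (X : metricType R) (F : X -> set X)
    (eps : R) : \bar R :=
  limn_esup (fun n : nat => ((n%:R^-1)%:E * lne (sep_number F n eps))%E).

Definition topological_entropy (R : realType) (X : metricType R)
    (F : X -> set X) : \bar R :=
  lim (entropy_at F eps @[eps --> 0^'+]).

(* Main.v *)
Require Import Defs.
From HB Require Import structures.
From mathcomp Require Import all_boot all_order all_algebra.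
From mathcomp Require Import all_classical all_reals all_analysis.
Set Implicit Arguments.
Unset Strict Implicit.
Unset Printing Implicit Defensive.
Import Order.TTheory GRing.Theory Num.Theory.
Import numFieldTopology.Exports numFieldNormedType.Exports.
Local Open Scope classical_set_scope.
Local Open Scope ring_scope.

(** The orbits [a] and [b] pass through the same point [p], and a common
    period [M] (the product of their periods) makes both return to [p] at
    every multiple of [M].  At these times one may therefore switch freely
    between [a] and [b]: every word of [k] bits yields an orbit of length
    [k * M] that follows [a] or [b] on its [q]-th block of length [M]
    according to the [q]-th bit ([switchP]).  Being distinct and [M]-periodic,
    [a] and [b] differ at some time [j < M]; so two orbits coded by different
    words are at distance at least [delta = mdist (a j) (b j) > 0]
    ([orb_dist_switch]).  This gives [2 ^ k] separated orbits of length
    [k * M], that is, entropy at least [ln 2 / M] at every scale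
    [eps <= delta] ([entropy_at_horseshoe]).  As the entropy at scale [eps]
    grows when [eps] decreases ([entropy_at_nonincreasing]), its limit at [0]
    exists and inherits this bound. *)

(** * Limits superior *)

Lemma limn_esup_ge_frequently (R : realType) (u : nat -> \bar R) (c : \bar R) :
  (forall N, exists2 n, (N <= n)%N & (c <= u n)%E) -> (c <= limn_esup u)%E.
Proof.
move=> cu; apply: le_ereal_inf_tmp => _ [V [N _ NV] <-].
have [n Nn cun] := cu N; apply: (le_trans cun).
by apply: ereal_sup_ubound; exists n => //; exact: NV.
Qed.

Lemma le_limn_esup (R : realType) (u v : nat -> \bar R) :
  (forall n, (u n <= v n)%E) -> (limn_esup u <= limn_esup v)%E.
Proof.
move=> uv; apply: le_ereal_inf_tmp => _ [V FV <-].
apply: (@le_trans _ _ (ereal_sup (u @` V))).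
  by apply: ereal_inf_lbound; exists V.
apply: ge_ereal_sup => _ [n Vn <-]; apply: (le_trans (uv n)).
by apply: ereal_sup_ubound; exists n.
Qed.

(** * Separated sets of orbits *)

Lemma card_range_inj (T : finType) (U : Type) (f : T -> U) :
  injective f -> (range f #= `I_#|T|)%card.
Proof.
move=> f_inj.
have rfT : (range f #= [set: T])%card.
  by apply: inj_card_eq => x y _ _; exact: f_inj.
have rTI : (range (@enum_rank T) #= [set: T])%card.
  by apply: inj_card_eq => x y _ _; exact: enum_rank_inj.
have rE : range (@enum_rank T) = [set: 'I_#|T|].
  by apply/seteqP; split => // i _; exists (enum_val i) => //; exact: enum_valK.
apply: (card_eq_trans rfT); rewrite card_eq_sym.
by apply: (card_eq_trans card_II); rewrite -rE.
Qed.

Lemma orb_distxx (R : realType) (X : metricType R) (n : nat)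
  (x : {ffun 'I_n -> X}) : orb_dist x x = 0.
Proof.
rewrite /orb_dist (eq_bigr (fun=> 0)) => [|i _]; last exact: mdistxx.
by elim/big_ind: _ => // y z -> ->; rewrite maxxx.
Qed.

Lemma sep_number_ge (R : realType) (X : metricType R) (F : X -> set X)
    (n : nat) (eps : R) (T : finType) (f : T -> {ffun 'I_n -> X}) :
  0 < eps -> (forall t, Orb F (f t)) ->
  (forall s t, s <> t -> eps <= orb_dist (f s) (f t)) ->
  ((#|T|%:R)%:E <= sep_number F n eps)%E.
Proof.
move=> eps0 fF fsep; apply: ereal_sup_ubound; exists #|T| => //.
exists (range f); split => [_ [t _ <-]//|_ _ [s _ <-] [t _ <-] st|].
  by apply: fsep => est; apply: st; rewrite est.
apply: card_range_inj => s t fst; apply: contrapT => /fsep.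
by rewrite fst orb_distxx leNgt eps0.
Qed.

Lemma sep_number_ge0 (R : realType) (X : metricType R) (F : X -> set X)
  (n : nat) (eps : R) : (0 <= sep_number F n eps)%E.
Proof.
apply: ereal_sup_ubound; exists 0%N => //.
by exists set0; split => [//|//|]; rewrite II0.
Qed.

Lemma sep_number_nonincreasing (R : realType) (X : metricType R)
    (F : X -> set X) (n : nat) (e1 e2 : R) :
  e1 <= e2 -> (sep_number F n e2 <= sep_number F n e1)%E.
Proof.
move=> e12; apply: ge_ereal_sup => _ [k [S [SF Ssep Sk]] <-].
apply: ereal_sup_ubound; exists k => //; exists S; split => // x y Sx Sy xy.
exact: le_trans (Ssep _ _ Sx Sy xy).
Qed.

Lemma entropy_at_nonincreasing (R : realType) (X : metricType R)
    (F : X -> set X) (e1 e2 : R) :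
  e1 <= e2 -> (entropy_at F e2 <= entropy_at F e1)%E.
Proof.
move=> e12; apply: le_limn_esup => n.
apply: lee_wpmul2l; first by rewrite lee_fin invr_ge0.
by rewrite lee_lne ?in_itv/= ?sep_number_ge0 ?leey// sep_number_nonincreasing.
Qed.

Lemma topological_entropy_ge (R : realType) (X : metricType R)
    (F : X -> set X) (delta : R) (c : \bar R) : 0 < delta ->
  (forall eps, 0 < eps -> eps <= delta -> (c <= entropy_at F eps)%E) ->
  (c <= topological_entropy F)%E.
Proof.
move=> delta0 cF; apply: lime_ge.
  apply: nonincreasing_at_right_is_cvge; apply: nearW => e x y _ _.
  exact: entropy_at_nonincreasing.
near=> e; apply: cF; first by near: e; exact: nbhs_right_gt.
by apply: ltW; near: e; exact: nbhs_right_lt.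
Unshelve. all: by end_near. Qed.

(** * Bi-infinite periodic sequences *)

Lemma periodic_mulz (T : Type) (x : int -> T) (m : nat) :
  (forall i, x i = x (i + m%:Z)) -> forall i q : int, x (i + q * m%:Z) = x i.
Proof.
move=> xm; have posq i (q : nat) : x (i + q%:Z * m%:Z) = x i.
  elim: q => [|q IH]; first by rewrite mul0r addr0.
  by rewrite -addn1 PoszD mulrDl mul1r addrA -xm.
by move=> i [q|q]; rewrite ?posq// NegzE -[LHS](posq _ q.+1) mulNr addrNK.
Qed.

Lemma periodic_neq (T : Type) (x y : int -> T) (m : nat) : (0 < m)%N ->
  (forall i, x i = x (i + m%:Z)) -> (forall i, y i = y (i + m%:Z)) ->
  x <> y -> exists2 j : nat, (j < m)%N & x j%:Z <> y j%:Z.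
Proof.
move=> m0 xm ym xy; apply: contrapT => xyE; apply: xy; apply/funext => i.
apply: contrapT => xyi; apply: xyE.
have m0z : m%:Z != 0 by rewrite eqz_nat -lt0n.
have rE : (`|(i %% m%:Z)%Z|%N)%:Z = (i %% m%:Z)%Z.
  by rewrite gez0_abs // modz_ge0.
exists `|(i %% m%:Z)%Z|%N; first by rewrite -ltz_nat rE ltz_pmod.
rewrite rE; move: xyi; rewrite {1 2}(divz_eq i m%:Z) addrC.
by rewrite !periodic_mulz.
Qed.

(** * Switching between two orbits *)

(** The value is read at time [i] itself rather than at [i %% M], which is the
    same for [M]-periodic [a] and [b] and makes steps inside a block plain
    steps of [a] or [b]. *)
Definition switch (T : Type) (a b : int -> T) (M : nat) (w : nat -> bool)
  (i : nat) : T := (if w (i %/ M)%N then a else b) i%:Z.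

(** Within a block the sequence follows a single orbit; at the end of a block
    both orbits stand at their common point, so it is immaterial which of the
    two the next block belongs to. *)
Lemma switchP (T : Type) (F : T -> set T) (a b : int -> T) (M : nat)
    (w : nat -> bool) (i : nat) :
  full_orbit F a -> full_orbit F b ->
  (forall i, a i = a (i + M%:Z)) -> (forall i, b i = b (i + M%:Z)) ->
  a 0 = b 0 -> (0 < M)%N ->
  F (switch a b M w i) (switch a b M w i.+1).
Proof.
move=> aF bF aM bM ab0 M0.
have -> : switch a b M w i.+1 = (if w (i %/ M)%N then a else b) i.+1%:Z.
  rewrite /switch divnS//; case: (boolP (M %| i.+1)%N) => [/dvdnP[q ->]|_//].
  have aq : a (q * M)%N%:Z = a 0 by rewrite PoszM -[_ * _]add0r periodic_mulz.
  have bq : b (q * M)%N%:Z = a 0.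
    by rewrite PoszM -[_ * _]add0r periodic_mulz// ab0.
  by do 2![case: ifP => _]; rewrite ?aq ?bq.
by rewrite /switch -[i.+1]addn1 PoszD; case: ifP.
Qed.

(** A word [w] of [k] bits, turned into an orbit segment of length [k * M]; the
    bits past the end of [w], never read, are set to [false]. *)
Definition switch_seg (T : Type) (a b : int -> T) (M k : nat)
    (w : k.-tuple bool) : {ffun 'I_(k * M) -> T} :=
  [ffun i : 'I_(k * M) => switch a b M (nth false w) i].

Lemma orb_dist_switch (R : realType) (X : metricType R) (a b : int -> X)
    (M j k : nat) (v w : k.-tuple bool) :
  (forall i, a i = a (i + M%:Z)) -> (forall i, b i = b (i + M%:Z)) ->
  (j < M)%N -> v <> w ->
  mdist (a j%:Z) (b j%:Z) <=
    orb_dist (switch_seg a b M v) (switch_seg a b M w).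
Proof.
move=> aM bM jM vw.
have [q vwq] : exists q : 'I_k, tnth v q != tnth w q.
  apply: contrapT => vwE; apply: vw; apply: eq_from_tnth => q.
  by apply/eqP; apply: contrapT => /negP vwq; apply: vwE; exists q.
(* the two orbits are apart at time j of the block of a bit where v, w differ *)
have lt_i : (q * M + j < k * M)%N.
  by apply: (@leq_trans (q.+1 * M)); rewrite ?leq_mul2r ?ltn_ord ?orbT//
             mulSn addnC ltn_add2r.
have M0 : (0 < M)%N by exact: leq_ltn_trans jM.
have iq : ((q * M + j) %/ M)%N = q by rewrite divnMDl// divn_small// addn0.
apply: le_trans (le_bigmax_cond _ _ (isT : xpredT (Ordinal lt_i))).
rewrite !ffunE /switch /= iq -!tnth_nth PoszD PoszM addrC.
by case: (tnth v q) (tnth w q) vwq => -[]// _; rewrite !periodic_mulz//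
  metric_sym.
Qed.

(** Along the lengths [k * M] there are [2 ^ k] separated orbits, and
    [ln (2 ^ k) / (k * M) = ln 2 / M]. *)
Lemma entropy_at_horseshoe (R : realType) (X : metricType R) (F : X -> set X)
    (a b : int -> X) (M j : nat) (eps : R) :
  full_orbit F a -> full_orbit F b ->
  (forall i, a i = a (i + M%:Z)) -> (forall i, b i = b (i + M%:Z)) ->
  a 0 = b 0 -> (j < M)%N ->
  0 < eps -> eps <= mdist (a j%:Z) (b j%:Z) ->
  ((ln 2 / M%:R)%:E <= entropy_at F eps)%E.
Proof.
move=> aF bF aM bM ab0 jM eps0 eps_ab.
have M0 : (0 < M)%N by exact: leq_ltn_trans jM.
apply: limn_esup_ge_frequently => N; exists (N.+1 * M)%N.
  by apply: leq_trans (leqnSn N) _; rewrite leq_pmulr.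
have := @sep_number_ge _ _ F (N.+1 * M) eps _ (@switch_seg _ a b M N.+1) eps0.
rewrite card_tuple card_bool => sep.
apply: (@le_trans _ _ (((N.+1 * M)%:R^-1)%:E * lne ((2 ^ N.+1)%:R)%:E)%E).
  rewrite lne_EFin ?ltr0n ?expn_gt0// -EFinM lee_fin natrX lnXn//.
  by rewrite [leRHS]mulrC natrM invfM mulrA -[ln 2 *+ _]mulr_natr mulfK ?pnatr_eq0.
apply: lee_wpmul2l; first by rewrite lee_fin invr_ge0.
rewrite lee_lne ?in_itv/= ?sep_number_ge0 ?leey ?lee_fin ?ler0n//; apply: sep.
  move=> w i i' ii'; rewrite !ffunE ii'.
  exact: switchP.
by move=> v w vw; apply: le_trans eps_ab _; exact: orb_dist_switch.
Qed.

Theorem theorem6p2 (R : realType) (X : metricType R) (F : X -> set X)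
  (hX : compact [set: X])
  (hF : forall x : X, hyperspace (F x))
  (Fusc : upper_semicontinuous F)
  (p : X) (a b : int -> X)
  (ha : periodic_orbit F a) (hb : periodic_orbit F b) (hab : a <> b)
  (ha0 : a 0 = p) (hb0 : b 0 = p) :
  (0 < topological_entropy F)%E.
Proof.
case: ha hb => aF [m [m0 am]] [bF [n [n0 bn]]].
have M0 : (0 < m * n)%N by rewrite muln_gt0 m0.
have aM i : a i = a (i + (m * n)%N%:Z).
  by rewrite mulnC PoszM periodic_mulz.
have bM i : b i = b (i + (m * n)%N%:Z) by rewrite PoszM periodic_mulz.
have [j jM abj] := periodic_neq M0 aM bM hab.
have d0 : 0 < mdist (a j%:Z) (b j%:Z) by rewrite mdist_gt0; apply/eqP.
apply: (@lt_le_trans _ _ (ln 2 / (m * n)%:R)%:E).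
  by rewrite lte_fin divr_gt0 ?ln_gt0 ?ltr1n ?ltr0n.
apply: (topological_entropy_ge d0) => eps eps0 epsd.
by apply: (entropy_at_horseshoe aF bF aM bM _ jM eps0 epsd); rewrite ha0 hb0.
Qed.
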